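(* Let $c=1/\sqrt{2}$, $d\in\mathbb{R}$, $a(n)=\lfloor cn+d\rfloor$ for $n\in\mathbb{Z}$, and $f(n)=a(n)+a(n-1)$. Then \[ a\bigl(a(f(n))\bigr)=a(n)\quad\text{for all integers } n\ge 2 \] if and only if $d\in\bigl[\sqrt{2}/2,\ 2(\sqrt{2}-1)\bigr]$. *)

(* Defs.v *)
From Stdlib Require Import Reals ZArith.
Open Scope R_scope.

Definition c_slope : R := 1 / sqrt 2.

(* [Int_part] is the floor (not truncation towards zero):
   [IZR (Int_part r) <= r < IZR (Int_part r) + 1], see [base_Int_part]. *)
Definition a_seq (d : R) (n : Z) : Z := Int_part (c_slope * IZR n + d).

Definition f_seq (d : R) (n : Z) : Z := (a_seq d n + a_seq d (n - 1))%Z.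

(* Main.v *)
Require Import Defs.
From Stdlib Require Import Reals ZArith.
From Stdlib Require Import Lra Lia.
Open Scope R_scope.

(** Write [c n + d = m + t] with [m = a(n)] and [0 <= t < 1]. Since [2 c^2 = 1],
    the number [a(f(n))] equals [n + e], where [e] is the floor of
    [d (1 + 2 c) - 2 c t], diminished by [c] before taking the floor when [t < c].
    The identity [a(n + e) = m] then only depends on [t]. For [d] in the
    interval it holds for all [t], except for [t = c] at the right endpoint, which
    occurs only for [n = -3] because [sqrt 2] is irrational. For [d] too small it
    fails for [t] slightly below [c], for [d] too large it fails for [t] slightly
    above [c], and such [t] occur because the [c n + d] with [n >= 2] are dense
    modulo 1. *)

Lemma Int_part_eq_iff (r : R) (z : Z) :
  Int_part r = z <-> IZR z <= r < IZR z + 1.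
Proof.
  split.
  - intros <-. destruct (base_Int_part r). lra.
  - intros H. symmetry. apply Int_part_spec. lra.
Qed.

Lemma c_slope_sqr : c_slope * c_slope = 1 / 2.
Proof.
  unfold c_slope. pose proof (sqrt_lt_R0 2 ltac:(lra)).
  pose proof (sqrt_sqrt 2 ltac:(lra)) as E.
  rewrite <- E at 3. field. lra.
Qed.

Lemma sqrt2_c_slope : sqrt 2 = 2 * c_slope.
Proof.
  unfold c_slope. pose proof (sqrt_lt_R0 2 ltac:(lra)).
  pose proof (sqrt_sqrt 2 ltac:(lra)).
  apply Rmult_eq_reg_r with (sqrt 2); [|lra]. field_simplify; lra.
Qed.

Lemma c_slope_bounds : 7 / 10 < c_slope < 71 / 100.
Proof.
  pose proof c_slope_sqr.
  assert (0 < c_slope)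
    by (unfold c_slope; apply Rdiv_lt_0_compat; [lra | apply sqrt_lt_R0; lra]).
  nra.
Qed.

(** Infinite descent: [x] is even, and with [x = 2 h] the pair [(y, h)] is a smaller solution. *)
Lemma sqr_eq_double_sqr (x y : Z) :
  (0 <= x -> 0 <= y -> x * x = 2 * (y * y) -> x = 0)%Z.
Proof.
  intros Hx. revert y. generalize Hx.
  pattern x. apply Z_lt_induction; [|exact Hx].
  clear x Hx. intros x IH Hx y Hy E.
  destruct (Z.eq_dec y 0) as [->|Hy0]; [nia|].
  destruct (Z.Even_or_Odd x) as [[h ->]|[h ->]]; [|lia].
  exfalso. apply Hy0.
  apply (IH y ltac:(nia) Hy h); lia.
Qed.

Lemma c_slope_irrational (q p : Z) : c_slope * IZR q = IZR p -> q = 0%Z.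
Proof.
  intros E.
  assert (H : (q * q = 2 * (p * p))%Z).
  { apply eq_IZR. rewrite !mult_IZR, <- E.
    replace (2 * (c_slope * IZR q * (c_slope * IZR q)))
      with (2 * (c_slope * c_slope) * (IZR q * IZR q)) by ring.
    rewrite c_slope_sqr. field. }
  pose proof (sqr_eq_double_sqr (Z.abs q) (Z.abs p)). lia.
Qed.

(* The witnesses are the odd powers of [sqrt 2 - 1]. *)
Lemma c_slope_small_combination (eps : R) :
  0 < eps ->
  exists q p : Z, (1 <= q)%Z /\ 0 < c_slope * IZR q + IZR p < eps.
Proof.
  intros Heps.
  pose proof c_slope_bounds. pose proof c_slope_sqr as Hc2.
  set (u := 2 * c_slope - 1).
  assert (powers : forall k : nat, exists Q P : Z, (1 <= Q)%Z /\ (P <= 0)%Z /\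
            c_slope * IZR (2 * Q) + IZR P = u * (u * u) ^ k).
  { induction k as [|k [Q [P [HQ [HP E]]]]].
    - exists 1%Z, (-1)%Z. repeat split; try lia. simpl. unfold u. lra.
    (* Multiplication by [u^2 = 3 - 4 c], reduced with [2 c^2 = 1]; the sign of [P] keeps the new
       [Q] positive. *)
    - exists (3 * Q - 2 * P)%Z, (3 * P - 4 * Q)%Z. repeat split; try lia.
      replace (u * (u * u) ^ S k) with (u * (u * u) ^ k * (u * u)) by (simpl; ring).
      rewrite <- E. unfold u.
      rewrite ?mult_IZR, ?minus_IZR, ?mult_IZR.
      replace ((2 * c_slope - 1) * (2 * c_slope - 1))
        with (4 * (c_slope * c_slope) - 4 * c_slope + 1) by ring.
      rewrite Hc2.
      transitivity (6 * c_slope * IZR Q - 4 * c_slope * IZR P + 3 * IZR P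
                    - 8 * (c_slope * c_slope) * IZR Q); [rewrite Hc2|]; ring_simplify; lra. }
  destruct (pow_lt_1_zero (u * u)) with (y := eps) as [k Hk]; [|exact Heps|].
  { rewrite Rabs_pos_eq; unfold u; nra. }
  specialize (Hk k (le_n k)).
  assert (0 < (u * u) ^ k) by (apply pow_lt; unfold u; nra).
  rewrite Rabs_pos_eq in Hk by lra.
  destruct (powers k) as [Q [P [HQ [_ E]]]].
  exists (2 * Q)%Z, P. split; [lia|]. rewrite E.
  assert (0 < u < 1) by (unfold u; lra). nra.
Qed.

(** From a value below [alpha] at [n = 2], steps of size [delta < beta - alpha] cannot jump over the
    interval, and each raises [n] by [q >= 1]. *)
Lemma c_slope_dense_mod1 (d alpha beta : R) :
  alpha < beta ->
  exists n m : Z, (2 <= n)%Z /\ alpha < c_slope * IZR n + d - IZR m < beta.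
Proof.
  intros Hab.
  destruct (c_slope_small_combination (beta - alpha)) as [q [p [Hq Hd]]]; [lra|].
  set (delta := c_slope * IZR q + IZR p) in *.
  set (m0 := up (c_slope * 2 + d - alpha)).
  destruct (archimed (c_slope * 2 + d - alpha)) as [Hm0 _]. fold m0 in Hm0.
  set (r := (alpha - (c_slope * 2 + d - IZR m0)) / delta).
  assert (Er : r * delta = alpha - (c_slope * 2 + d - IZR m0))
    by (unfold r; field; lra).
  assert (Hr : 0 < r) by nra.
  destruct (archimed r) as [Hj1 Hj2]. set (j := up r) in *.
  assert (Hj : (0 < j)%Z) by (apply lt_IZR; lra).
  exists (2 + j * q)%Z, (m0 - j * p)%Z. split; [nia|].
  rewrite plus_IZR, minus_IZR, !mult_IZR.
  replace (c_slope * (2 + IZR j * IZR q) + d - (IZR m0 - IZR j * IZR p))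
    with (c_slope * 2 + d - IZR m0 + IZR j * delta) by (unfold delta; ring).
  nra.
Qed.

(** Here [a(n-1) = m - 1], so [f(n) = 2 m - 1]; substitute [m = c n + d - t] and use [2 c^2 = 1]. *)
Lemma a_f_low (d : R) (n m : Z) :
  0 <= c_slope * IZR n + d - IZR m < c_slope ->
  a_seq d (f_seq d n) =
  Int_part (IZR n + (d * (1 + 2 * c_slope)
                     - 2 * c_slope * (c_slope * IZR n + d - IZR m) - c_slope)).
Proof.
  intros Ht. pose proof c_slope_bounds. pose proof c_slope_sqr as Hc2.
  assert (E1 : a_seq d n = m) by (apply Int_part_eq_iff; lra).
  assert (E2 : a_seq d (n - 1) = (m - 1)%Z)
    by (apply Int_part_eq_iff; rewrite !minus_IZR; lra).
  unfold f_seq. rewrite E1, E2. unfold a_seq. f_equal.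
  rewrite plus_IZR, minus_IZR.
  transitivity (IZR n + (d * (1 + 2 * c_slope) - 2 * (c_slope * c_slope) * IZR n
    - 2 * c_slope * (d - IZR m) - c_slope)); [rewrite Hc2|]; field.
Qed.

(** Now [a(n-1) = m], so [f(n) = 2 m] and the extra [- c] disappears. *)
Lemma a_f_high (d : R) (n m : Z) :
  c_slope <= c_slope * IZR n + d - IZR m < 1 ->
  a_seq d (f_seq d n) =
  Int_part (IZR n + (d * (1 + 2 * c_slope)
                     - 2 * c_slope * (c_slope * IZR n + d - IZR m))).
Proof.
  intros Ht. pose proof c_slope_bounds. pose proof c_slope_sqr as Hc2.
  assert (E1 : a_seq d n = m) by (apply Int_part_eq_iff; lra).
  assert (E2 : a_seq d (n - 1) = m)
    by (apply Int_part_eq_iff; rewrite !minus_IZR; lra).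
  unfold f_seq. rewrite E1, E2. unfold a_seq. f_equal.
  rewrite plus_IZR.
  transitivity (IZR n + (d * (1 + 2 * c_slope) - 2 * (c_slope * c_slope) * IZR n
    - 2 * c_slope * (d - IZR m))); [rewrite Hc2|]; field.
Qed.

Lemma a_a_f_eq (d : R) (n : Z) :
  c_slope <= d <= 2 * (2 * c_slope - 1) -> (2 <= n)%Z ->
  a_seq d (a_seq d (f_seq d n)) = a_seq d n.
Proof.
  intros Hd Hn. pose proof c_slope_bounds. pose proof c_slope_sqr as Hc2.
  remember (a_seq d n) as m eqn:Em. symmetry in Em.
  pose proof (proj1 (Int_part_eq_iff _ _) Em) as Hm.
  set (t := c_slope * IZR n + d - IZR m).
  (* As [2 c^2 = 1], the two endpoints for [d] give exactly [1 + c] and [2]. *)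
  assert (HA : 1 + c_slope <= d * (1 + 2 * c_slope) <= 2) by nra.
  destruct (Rlt_or_le t c_slope) as [Ht|Ht].
  - rewrite (a_f_low d n m) by (unfold t in Ht; lra). fold t.
    assert (0 <= t) by (unfold t; lra).
    (* The shift [e] is 0 or 1. If it is 1, then [t <= c (1 - c) = c - 1/2], so [t + c < 1] and
       [a(n+1)] is still [m]. *)
    destruct (Rlt_or_le (d * (1 + 2 * c_slope) - 2 * c_slope * t - c_slope) 1).
    + rewrite (proj2 (Int_part_eq_iff _ n)); [exact Em|]. nra.
    + rewrite (proj2 (Int_part_eq_iff _ (n + 1)%Z)) by (rewrite plus_IZR; nra).
      apply Int_part_eq_iff. rewrite plus_IZR.
      assert (t + c_slope < 1) by nra. unfold t in *. lra.
  - rewrite (a_f_high d n m) by (unfold t in Ht; lra). fold t.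
    assert (t < 1) by (unfold t; lra).
    rewrite (proj2 (Int_part_eq_iff _ n)); [exact Em|].
    split; [nra|].
    destruct (Rlt_or_le (d * (1 + 2 * c_slope) - 2 * c_slope * t) 1); [lra|].
    exfalso.
    (* A shift of at least 1 forces equality in [t >= c] and [d (1 + 2 c) <= 2]; then
       [c (n + 3) = m + 2]. *)
    assert (Et : t = c_slope) by nra.
    assert (Ed : d = 2 * (2 * c_slope - 1)) by nra.
    enough ((n + 3)%Z = 0%Z) by lia.
    apply c_slope_irrational with (m + 2)%Z.
    rewrite !plus_IZR. unfold t in Et. lra.
Qed.

Theorem theorem4p1 (d : R) :
  (forall n : Z, (2 <= n)%Z -> a_seq d (a_seq d (f_seq d n)) = a_seq d n) <->
  sqrt 2 / 2 <= d <= 2 * (sqrt 2 - 1).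
Proof.
  rewrite sqrt2_c_slope.
  replace (2 * c_slope / 2) with c_slope by field.
  split; [|intros Hd n; exact (a_a_f_eq d n Hd)].
  intros Ha. pose proof c_slope_bounds. pose proof c_slope_sqr as Hc2.
  set (A := d * (1 + 2 * c_slope)).
  split.
  - apply Rnot_lt_le. intros Hd.
    assert (HA : A < 1 + c_slope) by (unfold A; nra).
    (* [(A - c) c = (A - c) / (2 c)] is where the shift becomes negative. *)
    destruct (c_slope_dense_mod1 d (Rmax 0 ((A - c_slope) * c_slope)) c_slope)
      as [n [m [Hn Ht]]]; [apply Rmax_lub_lt; nra|].
    pose proof (Rmax_l 0 ((A - c_slope) * c_slope)).
    pose proof (Rmax_r 0 ((A - c_slope) * c_slope)).
    assert (Em : a_seq d n = m) by (apply Int_part_eq_iff; lra).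
    specialize (Ha n Hn). rewrite Em, (a_f_low d n m) in Ha by lra.
    fold A in Ha. set (t := c_slope * IZR n + d - IZR m) in *.
    assert (A - 2 * c_slope * t - c_slope < 0) by nra.
    destruct (base_Int_part (IZR n + (A - 2 * c_slope * t - c_slope))) as [Hk _].
    set (k := Int_part _) in *.
    (* Since [t < c], already [c (n - 1) + d < m], so [a(k) < m]. *)
    assert (Hkn : (k <= n - 1)%Z) by (enough (k < n)%Z by lia; apply lt_IZR; lra).
    apply IZR_le in Hkn. rewrite minus_IZR in Hkn.
    apply Int_part_eq_iff in Ha. unfold t in *. nra.
  - apply Rnot_lt_le. intros Hd.
    assert (HA : 2 < A) by (unfold A; nra).
    (* The shift [A - 2 c t] exceeds 1 for [t] below [(A - 1) c], which is larger than [c] because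
       [A > 2]. *)
    destruct (c_slope_dense_mod1 d c_slope (Rmin 1 ((A - 1) * c_slope)))
      as [n [m [Hn Ht]]]; [apply Rmin_glb_lt; nra|].
    pose proof (Rmin_l 1 ((A - 1) * c_slope)).
    pose proof (Rmin_r 1 ((A - 1) * c_slope)).
    assert (Em : a_seq d n = m) by (apply Int_part_eq_iff; lra).
    specialize (Ha n Hn). rewrite Em, (a_f_high d n m) in Ha by lra.
    fold A in Ha. set (t := c_slope * IZR n + d - IZR m) in *.
    assert (1 < A - 2 * c_slope * t) by nra.
    destruct (base_Int_part (IZR n + (A - 2 * c_slope * t))) as [_ Hk].
    set (k := Int_part _) in *.
    (* Since [t + c > 2 c > 1], already [c (n + 1) + d > m + 1], so [a(k) > m]. *)
    assert (Hkn : (n + 1 <= k)%Z) by (enough (n < k)%Z by lia; apply lt_IZR; lra).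
    apply IZR_le in Hkn. rewrite plus_IZR in Hkn.
    apply Int_part_eq_iff in Ha. unfold t in *. nra.
Qed.
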